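(* Let $(\Omega,\mathcal F)$ be a measurable space with a filtration $\{\mathcal F_m\}_{m=0}^\infty$, $\mathcal F_0=\{\emptyset,\Omega\}$, and let $M$ be a convex set of equivalent measures on $\mathcal F$. Suppose that the set $A_0$ contains only $1\le k<\infty$ linearly independent elements $\xi_1,\dots,\xi_k$. Let $f_N\ge0$, $N<\infty$, be $\mathcal F_N$-measurable and integrable relative to every measure $P\in M$. If there exist $\xi_0\in T$ and $\alpha_0\ge0$ such that $$P\big(f_N-\alpha_0E^P\{\xi_0|\mathcal F_N\}\le0\big)=1,\qquad P\in M,$$ where $$T=\Big\{\xi\ge0:\ \xi=\sum_{i=1}^k\alpha_i\xi_i,\ \alpha_i\ge0,\ i=1,\dots,k,\ \sum_{i=1}^k\alpha_i=1\Big\},$$ then a fair price $f_0$ of the contingent claim $f_N$ relative to $M$ exists.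
   Context: $M$ is a convex set of mutually equivalent probability measures on $\mathcal F$; $E^P$ is expectation under $P$. $A_0$ is the set of all nonnegative random variables $\xi$, integrable relative to all $P\in M$, with $E^P\xi=1$ for all $P\in M$. Fair price. Let $f_N$, $N<\infty$, be $\mathcal F_N$-measurable, integrable relative to $M$, and such that for some $0\le\alpha_0<\infty$, $\xi_0\in A_0$, $P(f_N-\alpha_0E^P\{\xi_0|\mathcal F_N\}\le0)=1$. Put $G_{\alpha_0}=\{\alpha\in[0,\alpha_0]:\ \exists\,\xi_\alpha\in A_0,\ P(f_N-\alpha E^P\{\xi_\alpha|\mathcal F_N\}\le0)=1\}$. The number $f_0=\inf_{\alpha\in G_{\alpha_0}}\alpha$ is called a fair price of the contingent claim $f_N$ relative to $M$ if there exist $\zeta_0\in A_0$ and sequences $\alpha_n\in[0,\alpha_0]$, $\xi_{\alpha_n}\in A_0$ with $\alpha_n\to f_0$, $\xi_{\alpha_n}\to\zeta_0$ in probability as $n\to\infty$, and $P(f_N-\alpha_nE^P\{\xi_{\alpha_n}|\mathcal F_N\}\le0)=1$ for all $n\ge1$. Here $P$ ranges over $M$. *)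

(* Defs.v *)
From HB Require Import structures.
From mathcomp Require Import all_boot all_order all_algebra.
From mathcomp Require Import all_classical all_reals all_analysis.

Set Implicit Arguments.
Unset Strict Implicit.
Unset Printing Implicit Defensive.

Import Order.TTheory GRing.Theory Num.Theory.
Import numFieldNormedType.Exports.
Local Open Scope classical_set_scope.
Local Open Scope ring_scope.

Definition is_filtration (d : measure_display) (T : measurableType d)
    (F : nat -> set (set T)) : Prop :=
  [/\ forall m, sigma_algebra setT (F m),
      forall m, F m `<=` measurable &
      forall m n, (m <= n)%N -> F m `<=` F n].

(* The convex combination is required to be in [M] only up to its values on
   measurable sets: a library measure is a function on all subsets of [T]. *)
Definition convex_measures (d : measure_display) (T : measurableType d)
    (R : realType) (M : set (probability T R)) : Prop :=
  forall (P Q : probability T R) (a : R), M P -> M Q -> 0 <= a <= 1 ->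
  exists2 S : probability T R, M S & forall A, measurable A ->
    S A = (a%:E * P A + (1 - a)%:E * Q A)%E.

Definition equivalent_measures (d : measure_display) (T : measurableType d)
    (R : realType) (M : set (probability T R)) : Prop :=
  forall P Q : probability T R, M P -> M Q -> P `<< Q.

Definition integrable_rel (d : measure_display) (T : measurableType d)
    (R : realType) (M : set (probability T R)) (x : T -> R) : Prop :=
  forall P : probability T R, M P -> P.-integrable setT (EFin \o x).

Definition A0 (d : measure_display) (T : measurableType d) (R : realType)
    (M : set (probability T R)) : set (T -> R) :=
  [set x : T -> R | [/\ measurable_fun setT x, forall w, 0 <= x w,
               integrable_rel M x &
               forall P : probability T R, M P -> ('E_P[x] = 1)%E]].

(* Random variables are identified when they agree almost surely, so a linear
   relation is an almost sure one. *)
Definition as_lin_indep (d : measure_display) (T : measurableType d)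
    (R : realType) (M : set (probability T R)) (m : nat)
    (x : 'I_m -> T -> R) : Prop :=
  forall c : 'I_m -> R,
  (forall P : probability T R, M P ->
     {ae P, forall w, \sum_(i < m) c i * x i w = 0}) ->
  forall i, c i = 0.

Definition only_lin_indep (d : measure_display) (T : measurableType d)
    (R : realType) (M : set (probability T R)) (A : set (T -> R)) (k : nat)
    (x : 'I_k -> T -> R) : Prop :=
  [/\ forall i, A (x i), as_lin_indep M x &
      forall (m : nat) (y : 'I_m -> T -> R),
        (forall i, A (y i)) -> as_lin_indep M y -> (m <= k)%N].

Definition convex_hull_T (d : measure_display) (T : measurableType d)
    (R : realType) (k : nat) (xi : 'I_k -> T -> R) : set (T -> R) :=
  [set x | (forall w, 0 <= x w) /\
           exists a : 'I_k -> R, [/\ forall w, x w = \sum_(i < k) a i * xi i w,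
                                     forall i, 0 <= a i &
                                     \sum_(i < k) a i = 1]].

Definition measurable_wrt (d : measure_display) (T : measurableType d)
    (R : realType) (G : set (set T)) (f : T -> R) : Prop :=
  forall B : set R, measurable B -> G (f @^-1` B).

(* [Y] is a version of the conditional expectation of [X] under [P] given the
   sub-sigma-algebra [G]. *)
Definition is_cond_expectation (d : measure_display) (T : measurableType d)
    (R : realType) (P : probability T R) (G : set (set T)) (X Y : T -> R)
    : Prop :=
  [/\ measurable_wrt G Y, P.-integrable setT (EFin \o Y) &
      forall A, G A -> (\int[P]_(w in A) (Y w)%:E = \int[P]_(w in A) (X w)%:E)%E].

(* P(f - a E^P{x|G} <= 0) = 1 for all P in M; versions being almost surely
   unique, the choice of the version [Y] is immaterial. *)
Definition dominated (d : measure_display) (T : measurableType d)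
    (R : realType) (M : set (probability T R)) (G : set (set T))
    (f : T -> R) (a : R) (x : T -> R) : Prop :=
  forall P : probability T R, M P ->
  exists2 Y : T -> R, is_cond_expectation P G x Y &
    P [set w | f w - a * Y w <= 0] = 1%E.

Definition price_set (d : measure_display) (T : measurableType d)
    (R : realType) (M : set (probability T R)) (G : set (set T))
    (f : T -> R) (a0 : R) : set R :=
  [set a | 0 <= a <= a0 /\ exists2 x, A0 M x & dominated M G f a x].

Definition cvg_in_prob (d : measure_display) (T : measurableType d)
    (R : realType) (P : probability T R) (x : nat -> T -> R) (z : T -> R)
    : Prop :=
  forall e : R, 0 < e ->
  (fun n => P [set w | e <= `|x n w - z w|]) @ \oo --> 0%E.

Definition is_fair_price (d : measure_display) (T : measurableType d)
    (R : realType) (M : set (probability T R)) (F : nat -> set (set T))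
    (N : nat) (f : T -> R) (a0 f0 : R) : Prop :=
  [/\ measurable_wrt (F N) f /\ integrable_rel M f,
      0 <= a0 /\ (exists2 x0, A0 M x0 & dominated M (F N) f a0 x0),
      f0 = inf (price_set M (F N) f a0) &
      exists (z0 : T -> R) (a : nat -> R) (x : nat -> T -> R),
        [/\ A0 M z0,
            forall n, 0 <= a n <= a0 /\ A0 M (x n),
            a @ \oo --> f0,
            forall P : probability T R, M P -> cvg_in_prob P x z0 &
            forall n, dominated M (F N) f (a n) (x n)]].

(* Main.v *)
(** Linear independence makes [c |-> E|sum_i c_i xi_i|] a norm on R^k, and by
    maximality every element of [A_0] is almost surely a combination of the
    [xi_i].  Elements of [A_0] have L1-norm 1, so their coefficient vectors are
    bounded.  Along prices [a_n] tending to the infimum, the coefficient vectors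
    of the dominating elements thus subconverge; the limit combination is an L1
    limit, hence lies in [A_0] and is also a limit in probability. *)
Require Import Defs.
From HB Require Import structures.
From mathcomp Require Import all_boot all_order all_algebra.
From mathcomp Require Import all_classical all_reals all_analysis.
From mathcomp Require Import measurable_realfun ring.
Import Order.TTheory GRing.Theory Num.Theory.
Import numFieldNormedType.Exports.
Local Open Scope classical_set_scope.
Local Open Scope ring_scope.

(** * Compactness in finite dimension *)

(** The hypotheses make [p] a norm, and Lipschitz, so it attains a minimum on the compact unit
    sphere. Definiteness makes this minimum positive, and by homogeneity its inverse serves as
    [b]. *)
Lemma norm_coercive {R : realType} {n : nat} {p : 'rV[R]_n -> R} (K : R) :
  (forall u v, p (u + v) <= p u + p v) ->
  (forall t u, p (t *: u) = `|t| * p u) ->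
  (forall u, p u <= K * `|u|) ->
  (forall u, p u = 0 -> u = 0) ->
  exists b : R, forall u, `|u| <= b * p u.
Proof.
move=> pD pZ pK p0.
have p_ge0 u : 0 <= p u.
  have := pD u (- u); rewrite subrr -[X in p X](scale0r u) -scaleN1r !pZ.
  by rewrite normr0 mul0r normrN1 mul1r -mulr2n pmulrn_lge0.
have p_lip u v : `|p u - p v| <= K * `|u - v|.
  have le1 x y : p x - p y <= K * `|x - y|.
    rewrite lerBlDr (le_trans _ (_ : p (x - y) + p y <= _))//.
      by have := pD (x - y) y; rewrite subrK.
    by rewrite lerD2r.
  by rewrite ler_norml le1 andbT lerNl opprB distrC le1.
have cp : continuous p.
  move=> u.
  apply: (cvgrPdist_le (FF := nbhs_filter u) _ _).2 => e e0; near=> v.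
  (* [K] may be zero or negative; [|K| + 1] is a Lipschitz constant one can divide by. *)
  rewrite (le_trans (p_lip _ _))// (@le_trans _ _ ((`|K| + 1) * `|u - v|))//.
    by rewrite ler_wpM2r// (le_trans (ler_norm _))// lerDl.
  rewrite mulrC -ler_pdivlMr ?ltr_wpDl//.
  near: v; apply/nbhs_ballP; exists (e / (`|K| + 1)).
    by rewrite /= divr_gt0// ltr_wpDl.
  by move=> v; rewrite mx_norm_ball => /ltW.
pose S := [set u : 'rV[R]_n | `|u| = 1].
(* The sphere is empty only when the zero vector is alone; then [b = 0] works. *)
have [[u0 Su0]|S0] := pselect (S !=set0); last first.
  exists 0 => u; rewrite mul0r.
  have [->|u0] := eqVneq u 0; first by rewrite normr0.
  exfalso; apply: S0; exists (`|u|^-1 *: u).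
  by rewrite /S/= normrZ normfV normr_id mulVf// normr_eq0.
have cS : compact S.
  apply: bounded_closed_compact.
    exists 1; split; first exact: num_real.
    by move=> x x1 u /= ->; exact: ltW.
  have -> : S = (fun u : 'rV[R]_n => `|u|) @^-1` [set 1] by [].
  by apply: closed_comp; [move=> u _; exact: norm_continuous|exact: closed_eq].
have [c Sc cmin] : exists2 c, c \in S & forall t, t \in S -> p c <= p t.
  by apply: EVT_min_rV => //; [exists u0|exact: continuous_subspaceT].
have pc : 0 < p c.
  rewrite lt_neqAle p_ge0 andbT eq_sym; apply/eqP => /p0 c0.
  by move: Sc; rewrite inE /S/= c0 normr0 => /eqP; rewrite eq_sym oner_eq0.
exists (p c)^-1 => u; have [->|u0'] := eqVneq u 0.
  by rewrite normr0 mulr_ge0// invr_ge0.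
have nu : 0 < `|u| by rewrite normr_gt0.
rewrite mulrC ler_pdivlMr//.
have : p c <= p (`|u|^-1 *: u).
  by apply: cmin; rewrite inE /S/= normrZ normfV normr_id mulVf// gt_eqF.
by rewrite pZ normfV normr_id mulrC ler_pdivlMr// mulrC.
Unshelve. all: by end_near. Qed.

(** The closed ball is compact, so [u] has a cluster point [c]; [phi i] is an index at or beyond [i]
    whose term is within [1/(i+1)] of [c]. No monotonicity of [phi] is claimed: [i <= phi i] is
    enough to preserve limits. *)
Lemma bounded_subseq_cvg {R : realType} {n : nat} {u : nat -> 'rV[R]_n} {b : R} :
  (forall i, `|u i| <= b) ->
  exists (c : 'rV[R]_n) (phi : nat -> nat),
    (forall i, (i <= phi i)%N) /\ (fun i => `|u (phi i) - c|) @ \oo --> 0.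
Proof.
move=> ub.
pose B := [set v : 'rV[R]_n | `|v| <= b].
have cB : compact B.
  apply: bounded_closed_compact.
    exists b; split; first exact: num_real.
    by move=> x bx v /= vb; rewrite (le_trans vb)// ltW.
  have -> : B = (fun v : 'rV[R]_n => `|v|) @^-1` [set x | x <= b] by [].
  by apply: closed_comp; [move=> v _; exact: norm_continuous|exact: closed_le].
have [|c [_ cc]] := cB (u @ \oo) _.
  by exists 0%N => // i _ /=; exact: ub.
have /choice[phi phiP] : forall i, exists j, (i <= j)%N /\ `|u j - c| < i.+1%:R^-1.
  move=> i.
  have [||v [[j ij <-]]] := cc (u @` [set j | (i <= j)%N]) (ball c i.+1%:R^-1).
  - by exists i => // j ij; exists j.
  - exact: nbhsx_ballx.
  - by rewrite mx_norm_ball /ball_/= distrC => h; exists j.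
exists c, phi; split=> [i|]; first by case: (phiP i).
apply: (@squeeze_cvgr _ _ _ _ (fun=> 0) (@harmonic R)).
- by near=> i; rewrite normr_ge0 /harmonic/= ltW//; case: (phiP i).
- exact: cvg_cst.
- exact: cvg_harmonic.
Unshelve. all: by end_near. Qed.

(** * Linear combinations and their L1 norms *)

(** Coefficients form a row vector, so that the max norm and compactness of ['rV[R]_k] apply to
    them. *)
Definition lincomb {R : realType} {T : Type} {k : nat} (xi : 'I_k -> T -> R)
    (c : 'rV[R]_k) (w : T) : R := \sum_(i < k) c 0 i * xi i w.

Lemma lincombD {R : realType} {T : Type} {k : nat} (xi : 'I_k -> T -> R)
    (u v : 'rV[R]_k) (w : T) :
  lincomb xi (u + v) w = lincomb xi u w + lincomb xi v w.
Proof.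
by rewrite /lincomb -big_split/=; apply: eq_bigr => i _; rewrite mxE mulrDl.
Qed.

Lemma lincombZ {R : realType} {T : Type} {k : nat} (xi : 'I_k -> T -> R)
    (t : R) (u : 'rV[R]_k) (w : T) :
  lincomb xi (t *: u) w = t * lincomb xi u w.
Proof.
by rewrite /lincomb mulr_sumr; apply: eq_bigr => i _; rewrite mxE mulrA.
Qed.

Lemma lincombB {R : realType} {T : Type} {k : nat} (xi : 'I_k -> T -> R)
    (u v : 'rV[R]_k) (w : T) :
  lincomb xi (u - v) w = lincomb xi u w - lincomb xi v w.
Proof. by rewrite lincombD -scaleN1r lincombZ mulN1r. Qed.

Lemma ler_norm_mx_coef {R : realType} {k : nat} (c : 'rV[R]_k) (i : 'I_k) :
  `|c 0 i| <= `|c|.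
Proof.
by rewrite [leRHS]/Num.norm /= mx_normrE; apply/bigmax_geP; right; exists (0, i).
Qed.

Lemma ler_norm_lincomb {R : realType} {T : Type} {k : nat} (xi : 'I_k -> T -> R)
    (c : 'rV[R]_k) (w : T) :
  `|lincomb xi c w| <= `|c| * \sum_(i < k) `|xi i w|.
Proof.
rewrite (le_trans (ler_norm_sum _ _ _))// mulr_sumr; apply: ler_sum => i _.
by rewrite normrM ler_wpM2r// ler_norm_mx_coef.
Qed.

Section L1.
Context {d : measure_display} {T : measurableType d} {R : realType}
  {P : probability T R} {k : nat} {xi : 'I_k -> T -> R}.
Hypothesis xiint : forall i, P.-integrable setT (EFin \o xi i).

Lemma integrable_lincomb (c : 'rV[R]_k) :
  P.-integrable setT (EFin \o lincomb xi c).
Proof.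
have -> : EFin \o lincomb xi c =
    (fun w => \sum_(i < k) ((c 0 i)%:E * (EFin \o xi i) w))%E.
  by apply/funext => w; rewrite /= /lincomb -sumEFin.
by apply: integrable_sum => // i _; exact: integrableZl.
Qed.

Lemma integrable_sum_norm :
  P.-integrable setT (EFin \o (fun w => \sum_(i < k) `|xi i w|)).
Proof.
have -> : EFin \o (fun w => \sum_(i < k) `|xi i w|) =
    (fun w => \sum_(i < k) (EFin \o (fun w => `|xi i w|%R)) w)%E.
  by apply/funext => w; rewrite /= -sumEFin.
by apply: integrable_sum => // i _; exact: integrable_norm.
Qed.

(** Continuity of the combination in L1 as a function of its coefficients. *)
Lemma Rintegral_norm_lincomb_le (c : 'rV[R]_k) :
  \int[P]_w `|lincomb xi c w| <=
  (\int[P]_w \sum_(i < k) `|xi i w|) * `|c|.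
Proof.
rewrite mulrC -RintegralZl//; last exact: integrable_sum_norm.
apply: le_Rintegral => //.
- exact/integrable_norm/integrable_lincomb.
- have -> : EFin \o (fun w => `|c| * \sum_(i < k) `|xi i w|) =
      (fun w => `|c|%:E * (EFin \o (fun w => (\sum_(i < k) `|xi i w|)%R)) w)%E by [].
  by apply: integrableZl => //; exact: integrable_sum_norm.
- by move=> w _; exact: ler_norm_lincomb.
Qed.

Lemma Rintegral_norm_eq0 (g : T -> R) : P.-integrable setT (EFin \o g) ->
  \int[P]_w `|g w| = 0 -> {ae P, forall w, g w = 0}.
Proof.
move=> ig g0.
have : (\int[P]_w `|(EFin \o g) w| = 0)%E.
  (* [fine] sends infinite values to 0, so finiteness of the integral has to come from
     integrability. *)
  rewrite -[LHS]fineK; first by congr EFin.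
  by apply: integrable_fin_num => //; exact/integrable_norm.
move=> /ae_eq_integral_abs -/(_ measurableT (measurable_int _ ig)).
by apply: filterS => w /(_ I) [].
Qed.

(** Independence makes the L1 norm definite on coefficient vectors, so [norm_coercive] applies. *)
Lemma lincomb_coef_bounded :
  (forall c : 'rV[R]_k, {ae P, forall w, lincomb xi c w = 0} -> c = 0) ->
  exists b : R, forall c : 'rV[R]_k, `|c| <= b * \int[P]_w `|lincomb xi c w|.
Proof.
move=> indep.
have iN c : P.-integrable setT (EFin \o (fun w => `|lincomb xi c w|)).
  exact: (integrable_norm (integrable_lincomb c)).
apply: (norm_coercive (\int[P]_w \sum_(i < k) `|xi i w|)).
- move=> u v; rewrite -RintegralD//; apply: le_Rintegral => //.
    have -> : EFin \o (fun w => `|lincomb xi u w| + `|lincomb xi v w|) =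
      ((EFin \o (fun w => `|lincomb xi u w|%R)) \+
       (EFin \o (fun w => `|lincomb xi v w|%R)))%E by [].
    exact: integrableD.
  by move=> w _; rewrite lincombD ler_normD.
- move=> t u; rewrite -RintegralZl//; apply: eq_Rintegral => w _.
  by rewrite lincombZ normrM.
- exact: Rintegral_norm_lincomb_le.
- move=> u u0; apply/indep/Rintegral_norm_eq0 => //.
  exact: integrable_lincomb.
Qed.

End L1.

(** * Consequences of L1 convergence *)

Section L1_limit.
Context {d : measure_display} {T : measurableType d} {R : realType}
  {P : probability T R} {x : nat -> T -> R} {z : T -> R}.
Hypothesis xint : forall n, P.-integrable setT (EFin \o x n).
Hypothesis zint : P.-integrable setT (EFin \o z).
Hypothesis xz : (fun n => \int[P]_w `|x n w - z w|) @ \oo --> 0.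

Let xzint n : P.-integrable setT (EFin \o (fun w => x n w - z w)).
Proof. exact: (integrableB measurableT (xint n) zint). Qed.

Lemma cvg_in_prob_L1 : cvg_in_prob P x z.
Proof.
move=> e e0.
apply: (@squeeze_cvge _ _ _ _ (fun=> 0%E) _
  (fun n => (e^-1 * \int[P]_w `|x n w - z w|)%:E)).
- near=> n; rewrite measure_ge0/= mulrC EFinM lee_pdivlMr// muleC.
  (* Markov's inequality for [x n - z] at level [e]. *)
  have := @le_integral_comp_abse _ _ _ P _ measurableT (EFin \o (x n \- z)) e id
    (@measurable_id _ _ _) (fun _ h => h) (fun _ _ _ _ h => h)
    (measurable_int _ (xzint n)) e0.
  rewrite setTI => /le_trans; apply.
  by rewrite fineK// integrable_fin_num//; exact: (integrable_norm (xzint n)).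
- exact: cvg_cst.
- apply: cvg_EFin; first exact: nearW.
  by rewrite -[X in _ --> X](mulr0 e^-1); apply: cvgMl_tmp.
Unshelve. all: by end_near. Qed.

Lemma cvg_Rintegral_L1 : (fun n => \int[P]_w x n w) @ \oo --> \int[P]_w z w.
Proof.
apply/cvgrPdist_le => e e0; have /cvgrPdist_le/(_ e e0) := xz.
apply: filterS => n; rewrite sub0r normrN distrC -RintegralB// => le_e.
apply: le_trans (le_trans (ler_norm _) le_e).
exact: (le_normr_Rintegral measurableT (xzint n)).
Qed.

End L1_limit.

(** As [g] is nonnegative, it equals [|lincomb xi u|] almost surely; the reverse triangle inequality
    then leaves the combination with coefficients [u - v]. *)
Lemma Rintegral_dist_lincomb {d : measure_display} {T : measurableType d}
    {R : realType} {P : probability T R} {k : nat} {xi : 'I_k -> T -> R}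
    {g : T -> R} {u v : 'rV[R]_k} :
  (forall i, P.-integrable setT (EFin \o xi i)) ->
  P.-integrable setT (EFin \o g) -> (forall w, 0 <= g w) ->
  {ae P, forall w, g w = lincomb xi u w} ->
  \int[P]_w `|g w - `|lincomb xi v w| | <=
  (\int[P]_w \sum_(i < k) `|xi i w|) * `|u - v|.
Proof.
move=> xiint gint g0 gu.
have il c : P.-integrable setT (EFin \o (fun w => `|lincomb xi c w|)).
  exact: (integrable_norm (integrable_lincomb xiint c)).
have ig : P.-integrable setT (EFin \o (fun w => `|g w - `|lincomb xi v w| |)).
  exact: (integrable_norm (integrableB measurableT gint (il v))).
have iu : P.-integrable setT
    (EFin \o (fun w => `| `|lincomb xi u w| - `|lincomb xi v w| |)).
  exact: (integrable_norm (integrableB measurableT (il u) (il v))).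
have -> : \int[P]_w `|g w - `|lincomb xi v w| | =
    \int[P]_w `| `|lincomb xi u w| - `|lincomb xi v w| |.
  congr fine; apply: ae_eq_integral => //; [exact: measurable_int ig|
    exact: measurable_int iu|].
  by apply: filterS gu => w guw _; rewrite -guw (ger0_norm (g0 w)).
apply: le_trans (Rintegral_norm_lincomb_le xiint (u - v)).
by apply: le_Rintegral => // w _; rewrite lincombB ler_dist_dist.
Qed.

(** * Structure of [A0] *)

Section price_density.
Context {d : measure_display} {T : measurableType d} {R : realType}
  {M : set (probability T R)}.

(** Expectation is L1-continuous, so the value 1 passes to the limit. A member of [M] turns
    integrability of [z] into measurability. *)
Lemma A0_L1_limit {x : nat -> T -> R} {z : T -> R} :
  M !=set0 -> (forall n, A0 M (x n)) -> (forall w, 0 <= z w) ->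
  integrable_rel M z ->
  (forall P, M P -> (fun n => \int[P]_w `|x n w - z w|) @ \oo --> 0) ->
  A0 M z.
Proof.
move=> [P0 MP0] Ax z0 iz xz; split => //.
  by apply/measurable_EFinP; exact: measurable_int (iz P0 MP0).
move=> P MP; rewrite unlock.
have ix n : P.-integrable setT (EFin \o x n) by case: (Ax n) => _ _ /(_ P MP).
have Ex n : \int[P]_w x n w = 1.
  by case: (Ax n) => _ _ _ /(_ P MP); rewrite unlock /Rintegral => ->.
have := cvg_Rintegral_L1 ix (iz P MP) (xz P MP).
under eq_fun do rewrite Ex.
move=> /(cvg_lim (@Rhausdorff R)); rewrite lim_cst// => z1.
rewrite -[LHS]fineK; first by congr EFin.
by apply: integrable_fin_num => //; exact: iz.
Qed.

(** By maximality, [x] together with the [xi i] is dependent. Independence of the [xi i] forces the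
    coefficient of [x] to be nonzero, and dividing by it gives one vector [c] valid for all measures
    of [M]. *)
Lemma A0_lincomb {k : nat} {xi : 'I_k -> T -> R} {x : T -> R} :
  only_lin_indep M (A0 M) xi -> A0 M x ->
  exists c : 'rV[R]_k,
    forall P, M P -> {ae P, forall w, x w = lincomb xi c w}.
Proof.
move=> [Axi xi_indep max_indep] Ax.
pose y (i : 'I_k.+1) := if unlift ord0 i is Some j then xi j else x.
have Ay i : A0 M (y i) by rewrite /y; case: unlift.
have : ~ as_lin_indep M y by move=> /(max_indep _ _ Ay); rewrite ltnn.
move=> /existsNP[a /not_implyP[a0 /existsNP[j aj]]].
have {}a0 P : M P ->
    {ae P, forall w, a ord0 * x w + \sum_(i < k) a (lift ord0 i) * xi i w = 0}.
  move=> /a0; apply: filterS => w; rewrite big_ord_recl /y unlift_none.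
  by under eq_bigr do rewrite liftK.
have ax0 : a ord0 != 0.
  apply/eqP => ax0; apply: aj; case: (unliftP ord0 j) => [i ->|-> //].
  apply: (xi_indep (fun i => a (lift ord0 i))) => P /a0; apply: filterS => w.
  by rewrite ax0 mul0r add0r.
exists (\row_i (- a (lift ord0 i) / a ord0)) => P /a0; apply: filterS => w.
move=> /eqP; rewrite addr_eq0 => /eqP axw.
apply: (mulfI ax0); rewrite axw /lincomb mulr_sumr -sumrN.
by apply: eq_bigr => i _; rewrite mxE; field.
Qed.

(** Equivalent measures share their null sets, so a relation holding almost surely under one [P]
    holds so under all of [M]. *)
Lemma lin_indep_ae {k : nat} {xi : 'I_k -> T -> R} {P : probability T R} :
  equivalent_measures M -> as_lin_indep M xi -> M P ->
  forall c : 'rV[R]_k, {ae P, forall w, lincomb xi c w = 0} -> c = 0.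
Proof.
move=> Meq xi_indep MP c c0; apply/rowP => i; rewrite mxE.
apply: (xi_indep (fun i => c 0 i)) => Q MQ.
have [A [mA PA0 cA]] := c0.
by exists A; split => //;
  apply: (null_content_dominatesP _ _).1 PA0 => //; exact: Meq.
Qed.

(** By linearity the expectation is the sum of the weights, which is 1. This is what makes [a0] an
    element of the price set. *)
Lemma convex_hull_T_A0 {k : nat} {xi : 'I_k -> T -> R} :
  (forall i, A0 M (xi i)) -> convex_hull_T xi `<=` A0 M.
Proof.
move=> Axi x [x0 [a [xE a0 a1]]].
have iax P i : M P -> P.-integrable setT (fun w => (a i)%:E * (xi i w)%:E)%E.
  by move=> MP; apply: integrableZl => //; case: (Axi i) => _ _ /(_ P MP).
have xEE : EFin \o x = (fun w => \sum_(i < k) (a i)%:E * (xi i w)%:E)%E.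
  by apply/funext => w; rewrite /= xE -sumEFin.
split => //.
- have -> : x = (fun w => \sum_(i < k) a i * xi i w) by exact/funext.
  by apply: measurable_sum => i; apply: measurable_funM => //; case: (Axi i).
- by move=> P MP; rewrite xEE; apply: integrable_sum => // i _; exact: iax.
- move=> P MP; rewrite unlock -/(EFin \o x) xEE integral_sum//; last first.
    by move=> i; exact: iax.
  rewrite -[RHS]/(1%:E) -a1 -sumEFin; apply: eq_bigr => i _.
  case: (Axi i) => _ _ /(_ P MP) ixi /(_ P MP) /=.
  rewrite unlock integralZl// => ->.
  by rewrite mule1.
Qed.

End price_density.

(** * Minimizing prices and the fair price *)

Lemma exists_seq_cvg_inf {R : realType} {E : set R} : has_inf E ->
  exists a : nat -> R, (forall n, E (a n)) /\ a @ \oo --> inf E.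
Proof.
move=> infE.
have /choice[a aP] : forall n, exists x, E x /\ x < inf E + n.+1%:R^-1.
  move=> n; have [|x Ex xlt] := @inf_adherent _ E n.+1%:R^-1 _ infE.
    by rewrite invr_gt0.
  by exists x.
exists a; split=> [n|]; first by case: (aP n).
apply: (@squeeze_cvgr _ _ _ _ (fun=> inf E) (fun n => inf E + n.+1%:R^-1)).
- near=> n; have [En /ltW ->] := aP n; rewrite andbT.
  by apply: ge_inf => //; case: infE.
- exact: cvg_cst.
- rewrite -[X in _ --> X]addr0.
  by apply: cvgD; [exact: cvg_cst|exact: cvg_harmonic].
Unshelve. all: by end_near. Qed.

Theorem theorem5p2 (R : realType) (d : measure_display) (T : measurableType d)
    (F : nat -> set (set T)) (M : set (probability T R))
    (k : nat) (xi : 'I_k -> T -> R) (N : nat) (f : T -> R)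
    (xi0 : T -> R) (a0 : R)
    (hF : is_filtration F) (hF0 : F 0%N = [set A | A = set0 \/ A = setT])
    (hMconv : convex_measures M) (hMeq : equivalent_measures M)
    (hk : (1 <= k)%N) (hxi : only_lin_indep M (A0 M) xi)
    (hf0 : forall w, 0 <= f w) (hfN : measurable_wrt (F N) f)
    (hfint : integrable_rel M f)
    (hxi0 : convex_hull_T xi xi0) (ha0 : 0 <= a0)
    (hdom : dominated M (F N) f a0 xi0) :
  exists f0 : R, is_fair_price M F N f a0 f0.
Proof.
have [Axi xi_indep _] := hxi.
(* Over an empty [M] every linear relation holds vacuously, so independence would force the
   coefficients 1 to vanish; [1 <= k] supplies an index. *)
have [P0 MP0] : M !=set0.
  apply: contrapT => M0.
  suff /(_ (Ordinal hk))/eqP : forall i : 'I_k, (1 : R) = 0 by rewrite oner_eq0.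
  by apply: (xi_indep (fun=> 1)) => P MP; exfalso; apply: M0; exists P.
have A0xi0 := convex_hull_T_A0 Axi _ hxi0.
pose G := price_set M (F N) f a0.
have infG : has_inf G.
  split; last by exists 0 => x [/andP[]].
  by exists a0; split; [rewrite ha0 lexx|exists xi0].
have [a [Ga a_inf]] := exists_seq_cvg_inf infG.
have xiint P : M P -> forall i, P.-integrable setT (EFin \o xi i).
  by move=> MP i; case: (Axi i) => _ _ /(_ P MP).
have /choice[x xP] : forall n, exists x, A0 M x /\ dominated M (F N) f (a n) x.
  by move=> n; case: (Ga n) => _ [x Ax fx]; exists x.
have /choice[c cP] : forall n, exists c : 'rV[R]_k,
    forall P, M P -> {ae P, forall w, x n w = lincomb xi c w}.
  by move=> n; apply: A0_lincomb hxi _; case: (xP n).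
(* One measure [P0] suffices for the bound, as the vectors [c n] are common to all of [M]. *)
have [b bP] :=
  lincomb_coef_bounded (xiint P0 MP0) (lin_indep_ae hMeq xi_indep MP0).
have xint P n : M P -> P.-integrable setT (EFin \o x n).
  by move=> MP; case: (xP n) => -[_ _ /(_ P MP)].
have cb n : `|c n| <= b.
  (* Under [P0] the L1 norm of the combination is the expectation of [x n], namely 1. *)
  have -> // : b = b * \int[P0]_w `|lincomb xi (c n) w|.
  rewrite -[LHS]mulr1; congr (_ * _).
  have [[_ x0 _ /(_ P0 MP0) Ex] _] := xP n; move: Ex; rewrite unlock => Ex.
  rewrite -[LHS]/(fine 1%E) -Ex; congr fine; apply: ae_eq_integral => //.
  - exact: measurable_int (xint P0 n MP0).
  - apply: measurable_int.
    exact: integrable_norm (integrable_lincomb (xiint P0 MP0) _).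
  - by apply: filterS (cP n P0 MP0) => w xc _; rewrite -xc ger0_norm.
have [c0 [phi [phi_ge c_cvg]]] := bounded_subseq_cvg cb.
(* The absolute value makes the limit nonnegative everywhere, as [A0] asks;
   the combination itself is only almost surely nonnegative. *)
pose z (w : T) : R := `|lincomb xi c0 w|.
have zint P : M P -> P.-integrable setT (EFin \o z).
  by move=> MP; exact: (integrable_norm (integrable_lincomb (xiint P MP) _)).
have xz P : M P -> (fun n => \int[P]_w `|x (phi n) w - z w|) @ \oo --> 0.
  move=> MP; apply: (@squeeze_cvgr _ _ _ _ (fun=> 0)
    (fun n => (\int[P]_w \sum_(i < k) `|xi i w|) * `|c (phi n) - c0|)).
  - near=> n; rewrite Rintegral_ge0//=.
    apply: Rintegral_dist_lincomb; [exact: xiint|exact: xint| |exact: cP].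
    by case: (xP (phi n)) => -[].
  - exact: cvg_cst.
  - by rewrite -[X in _ --> X](mulr0 (\int[P]_w \sum_(i < k) `|xi i w|));
      apply: cvgMl_tmp.
exists (inf G); split => //; first by split => //; exists xi0.
exists z, (a \o phi), (x \o phi); split.
- apply: (@A0_L1_limit _ _ _ _ (x \o phi)) => //.
  + by exists P0.
  + by move=> n; case: (xP (phi n)).
  + by move=> w; exact: normr_ge0.
- by move=> n; split; [case: (Ga (phi n))|case: (xP (phi n))].
(* Prices along [phi] keep the limit [inf G] because [n <= phi n]. *)
- apply: cvg_comp _ a_inf => A [m _ mA].
  by exists m => // n /= mn; apply: mA; exact: leq_trans (phi_ge n).
- move=> P MP; apply: cvg_in_prob_L1 (xz P MP); last exact: zint.
  by move=> n; exact: xint.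
- by move=> n; case: (xP (phi n)).
Unshelve. all: by end_near. Qed.
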